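(* For every integer $w \ge 12$ with $6 \mid w$, we have $$X_{w}' = \frac{5w}{72} X_{6} X_{w-4} + \frac{7w}{72} X_{8} X_{w - 6},$$ where for even $k\ge 6$, $X_k = X_{k,1}$ denotes the unique normalized extremal quasimodular form of weight $k$ and depth $1$.
   Context: Let $q=e^{2\pi i z}$, $E_2 = 1 - 24\sum_{n\ge1}\sigma_1(n)q^n$, $E_4 = 1+240\sum_{n\ge1}\sigma_3(n)q^n$, $E_6 = 1-504\sum_{n\ge1}\sigma_5(n)q^n$. Quasimodular forms for $\mathrm{SL}_2(\mathbb{Z})$ are the elements of $\mathbb{C}[E_2,E_4,E_6]$, graded by weight; depth is the degree in $E_2$; $\mathcal{QM}_w^s$ is the space of weight $w$, depth $\le s$. A form $f\in\mathcal{QM}_w^s\setminus\mathcal{QM}_w^{s-1}$ with $q$-expansion $\sum_{n\ge0}a_nq^n$ is extremal if, with $m=\dim_{\mathbb{C}}\mathcal{QM}_w^s$, one has $a_0=\dots=a_{m-2}=0$ and $a_{m-1}\ne0$; it is normalized if its first nonzero coefficient is $1$. For depth $1$ and every even $w\ge6$, a normalized extremal form $X_{w,1}$ exists and is unique; e.g. $X_{6,1} = (E_2E_4-E_6)/720$ and $X_{8,1}=(E_4^2-E_2E_6)/1008$. $X' = q\frac{dX}{dq}$. *)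

(* Defs.v *)
From HB Require Import structures.
From mathcomp Require Import all_boot all_order all_algebra.
From mathcomp Require Import boolp classical_sets reals.
From mathcomp Require Import complex mpoly.

Set Implicit Arguments.
Unset Strict Implicit.
Unset Printing Implicit Defensive.

Import GRing.Theory.
Local Open Scope ring_scope.

(* Formal power series K[[q]] with the Cauchy product, as a commutative       *)
(* K-algebra.  Modular objects are represented by their q-expansions.         *)
Record fps (K : Type) := FPS { fcoef : nat -> K }.

Section FPSAlgebra.
Variable K : comNzRingType.
Implicit Types (f g h : fps K) (a b : K) (n : nat).

HB.instance Definition _ := gen_eqMixin (fps K).
HB.instance Definition _ := gen_choiceMixin (fps K).

Lemma fpsP f g : (forall n, fcoef f n = fcoef g n) -> f = g.
Proof. by case: f g => [f] [g] /= fg; congr FPS; apply/funext. Qed.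

Definition fps_zero : fps K := FPS (fun _ => 0).
Definition fps_one : fps K := FPS (fun n => (n == 0%N)%:R).
Definition fps_opp f : fps K := FPS (fun n => - fcoef f n).
Definition fps_add f g : fps K := FPS (fun n => fcoef f n + fcoef g n).
Definition fps_scale a f : fps K := FPS (fun n => a * fcoef f n).
Definition fps_mul f g : fps K :=
  FPS (fun n => \sum_(j < n.+1) fcoef f j * fcoef g (n - j)).

Lemma fps_addA : associative fps_add.
Proof. by move=> f g h; apply/fpsP => n /=; rewrite addrA. Qed.
Lemma fps_addC : commutative fps_add.
Proof. by move=> f g; apply/fpsP => n /=; rewrite addrC. Qed.
Lemma fps_add0 : left_id fps_zero fps_add.
Proof. by move=> f; apply/fpsP => n /=; rewrite add0r. Qed.
Lemma fps_addN : left_inverse fps_zero fps_opp fps_add.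
Proof. by move=> f; apply/fpsP => n /=; rewrite addNr. Qed.

HB.instance Definition _ :=
  GRing.isZmodule.Build (fps K) fps_addA fps_addC fps_add0 fps_addN.

Definition fps_trunc N f : {poly K} := \poly_(i < N) fcoef f i.

Lemma fps_mul_trunc N f g n : (n < N)%N ->
  fcoef (fps_mul f g) n = (fps_trunc N f * fps_trunc N g)`_n.
Proof.
move=> nN; rewrite coefM /=; apply: eq_bigr => j _.
rewrite !coef_poly (leq_ltn_trans (leq_subr _ _) nN).
by rewrite (leq_ltn_trans _ nN) // -ltnS.
Qed.

Lemma fps_mulC : commutative fps_mul.
Proof.
by move=> f g; apply/fpsP => n; rewrite !(fps_mul_trunc _ _ (ltnSn n)) mulrC.
Qed.

Lemma fps_mulA : associative fps_mul.
Proof.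
have mul_l f g h n :
    fcoef (fps_mul f (fps_mul g h)) n =
    (fps_trunc n.+1 f * (fps_trunc n.+1 g * fps_trunc n.+1 h))`_n.
  rewrite coefM /=; apply: eq_bigr => j _.
  by rewrite coef_poly ltn_ord -fps_mul_trunc // ltnS leq_subr.
move=> f g h; apply/fpsP => n.
by rewrite mul_l (fps_mulC (fps_mul f g)) mul_l mulrA mulrC.
Qed.

Lemma fps_mul1 : left_id fps_one fps_mul.
Proof.
move=> f; apply/fpsP => n /=.
rewrite big_ord_recl /= mul1r subn0 big1 ?addr0 // => i _.
by rewrite mul0r.
Qed.

Lemma fps_mulDl : left_distributive fps_mul fps_add.
Proof.
move=> f g h; apply/fpsP => n /=.
by rewrite -big_split; apply: eq_bigr => i _ /=; rewrite mulrDl.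
Qed.

Lemma fps_one_neq0 : fps_one != 0 :> fps K.
Proof.
by apply/eqP => /(congr1 (fun f => fcoef f 0)) /= /eqP; rewrite oner_eq0.
Qed.

HB.instance Definition _ := GRing.Zmodule_isComNzRing.Build (fps K)
  fps_mulA fps_mulC fps_mul1 fps_mulDl fps_one_neq0.

Lemma fps_scaleA a b f : fps_scale a (fps_scale b f) = fps_scale (a * b) f.
Proof. by apply/fpsP => n /=; rewrite mulrA. Qed.
Lemma fps_scale1 : left_id 1 fps_scale.
Proof. by move=> f; apply/fpsP => n /=; rewrite mul1r. Qed.
Lemma fps_scaleDr : right_distributive fps_scale +%R.
Proof. by move=> a f g; apply/fpsP => n /=; rewrite mulrDr. Qed.
Lemma fps_scaleDl f : {morph fps_scale^~ f : a b / a + b}.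
Proof. by move=> a b; apply/fpsP => n /=; rewrite mulrDl. Qed.

HB.instance Definition _ := GRing.Zmodule_isLmodule.Build K (fps K)
  fps_scaleA fps_scale1 fps_scaleDr fps_scaleDl.

Lemma fps_scaleAl a f g : a *: (f * g) = (a *: f) * g.
Proof.
apply/fpsP => n /=; rewrite big_distrr /=.
by apply: eq_bigr => i _; rewrite mulrA.
Qed.

HB.instance Definition _ := GRing.Lmodule_isLalgebra.Build K (fps K) fps_scaleAl.
HB.instance Definition _ := GRing.Lalgebra_isComAlgebra.Build K (fps K).

End FPSAlgebra.

(* The derivation f |-> f' = q df/dq. *)
Definition fps_deriv (K : comNzRingType) (f : fps K) : fps K :=
  FPS (fun n => n%:R * fcoef f n).

(* V is a linear subspace admitting a basis with m elements. *)
Definition has_dim (K : fieldType) (L : lmodType K) (V : set L) (m : nat) :=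
  exists e : 'I_m -> L,
    (forall c : 'I_m -> K, \sum_i c i *: e i = 0 -> forall i, c i = 0) /\
    V = [set v | exists c : 'I_m -> K, v = \sum_i c i *: e i]%classic.

Definition sigma (k n : nat) : nat := (\sum_(d <- divisors n) d ^ k)%N.

(* The multinomial (a, b, c) stands for E2^a E4^b E6^c, of weight
   2a + 4b + 6c. *)
Definition qm_weight (m : 'X_{1..3}) : nat :=
  (\sum_(i < 3) m i * tnth [tuple 2; 4; 6] i)%N.

Lemma qm_weight0 : qm_weight 0%MM = 0%N.
Proof. by rewrite /qm_weight big1 // => i _; rewrite mnm0E. Qed.

Lemma qm_weightD : {morph qm_weight : m1 m2 / (m1 + m2)%MM >-> (m1 + m2)%N}.
Proof.
move=> m1 m2; rewrite /qm_weight -big_split /=.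
by apply: eq_bigr => i _; rewrite mnmDE mulnDl.
Qed.

HB.instance Definition _ := isMeasure.Build 3 qm_weight qm_weight0 qm_weightD.

Section Quasimodular.
Variable K : fieldType.

Definition E2 : fps K :=
  FPS (fun n => if n == 0%N then 1 else - 24%:R * (sigma 1 n)%:R).
Definition E4 : fps K :=
  FPS (fun n => if n == 0%N then 1 else 240%:R * (sigma 3 n)%:R).
Definition E6 : fps K :=
  FPS (fun n => if n == 0%N then 1 else - 504%:R * (sigma 5 n)%:R).

(* P(E2, E4, E6) *)
Definition eval_E (P : {mpoly K[3]}) : fps K :=
  mmap (GRing.in_alg (fps K)) (tnth [tuple E2; E4; E6]) P.

(* QM_w^s.  The depth bound s is an integer so that QM_w^(s-1) makes sense at
   s = 0, where it is the zero space. *)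
Definition quasimodular (w : nat) (s : int) : set (fps K) :=
  [set f | exists P : {mpoly K[3]},
     [/\ P \is w.-homog for qm_weight,
         {in msupp P, forall m : 'X_{1..3}, (m ord0)%:Z <= s} &
         f = eval_E P]]%classic.

Definition extremal (w : nat) (s : int) (f : fps K) : Prop :=
  [/\ quasimodular w s f,
      ~ quasimodular w (s - 1) f &
      exists m : nat,
        [/\ has_dim (quasimodular w s) m,
            forall i : nat, (i < m.-1)%N -> fcoef f i = 0 &
            fcoef f m.-1 <> 0]].

(* The first nonzero coefficient is 1. *)
Definition normalized (f : fps K) : Prop :=
  exists n : nat, (forall i : nat, (i < n)%N -> fcoef f i = 0) /\ fcoef f n = 1.

Definition normalized_extremal (w : nat) (s : int) (f : fps K) : Prop :=
  extremal w s f /\ normalized f.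

End Quasimodular.

(* Main.v *)
(* Put X_{6n} = P_n and X_{6n+2} = Q_n up to scalars.  They are generated from
   P_0 = 1, Q_0 = E2 by P_{n+1} ~ E4 Q_n - E6 P_n, Q_{n+1} ~ E4^2 P_n - E6 Q_n, and
   Ramanujan's formulas for E2', E4', E6' give by induction the system
     12 P_n' = (6n-1) E2 P_n + (6n+1) Q_n,
     12 Q_n' = (6n+1) E2 Q_n + (6n-1) E4 P_n.
   Comparing the coefficients of q^n in the first equation shows that P_n and Q_n,
   which vanish to order n, have the same n-th coefficient; the recursion then
   raises the order by one.  The theorem is the first equation at n+1 with P_{n+1},
   Q_{n+1} expanded by the recursion, since P_1 and Q_1 are multiples of X_6, X_8.

   P_n and Q_n are the only candidates: writing depth-one forms as A + B E2, the
   determinant of (P_n, Q_n) is a nonzero multiple of Delta^n, while those of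
   (h, P_n) and (h, Q_n) have weight at most 12n + 2 and order at least n whenever h
   vanishes to order n, so by Cramer's rule h is a multiple of P_n or Q_n.

   Ramanujan's formulas come from Skoruppa's argument: in a sum over positive
   solutions of a x + b y = n, the shear (a, x), (b, y) -> (a, x - y), (a + b, y)
   matches the solutions with x > y with those with b > a, and for polynomials
   g(a, c) invariant under (a, c) -> (c, c - a) this evaluates convolutions of
   divisor sums. *)
Require Import Defs.
From mathcomp Require Import all_boot all_order all_algebra.
From mathcomp Require Import boolp classical_sets reals.
From mathcomp Require Import complex mpoly.
From mathcomp Require Import zify ring.

Set Implicit Arguments.
Unset Strict Implicit.
Unset Printing Implicit Defensive.

Import Order.TTheory GRing.Theory Num.Theory.
Local Open Scope ring_scope.

(** * Sums over solutions of [a x + b y = n] *)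

Lemma perm_divisors n : (0 < n)%N ->
  perm_eq (divisors n) [seq d <- iota 1 n | (d %| n)%N].
Proof.
move=> n0; apply: uniq_perm; rewrite ?divisors_uniq ?filter_uniq ?iota_uniq //.
move=> d; rewrite -dvdn_divisors // mem_filter mem_iota.
case: (boolP (d %| n)%N) => //= dn.
by have := dvdn_leq n0 dn; have := dvdn_gt0 n0 dn; lia.
Qed.

(** A positive solution of [a * x <= n] has both sides at most [n], so this finite box contains all
    pairs that contribute. *)
Definition rectangles (n : nat) : seq (nat * nat) :=
  [seq (a, x) | a <- iota 1 n, x <- iota 1 n].

Lemma mem_rectangles n p :
  (p \in rectangles n) = (0 < p.1 <= n)%N && (0 < p.2 <= n)%N.
Proof.
case: p => a x; apply/allpairsP/idP => /= [[[b y] /=]|h].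
  by rewrite !mem_iota !add1n !ltnS => -[? ? [-> ->]]; lia.
by exists (a, x); rewrite !mem_iota; split=> //=; lia.
Qed.

(* Quadruples [((a, x), (b, y))] of positive integers with [a x + b y = n]. *)
Definition two_rectangles (n : nat) : seq (nat * nat * (nat * nat)) :=
  [seq s <- [seq (p, r) | p <- rectangles n, r <- rectangles n]
    | s.1.1 * s.1.2 + s.2.1 * s.2.2 == n]%N.

Lemma mem_two_rectangles n s :
  (s \in two_rectangles n) =
  [&& 0 < s.1.1, 0 < s.1.2, 0 < s.2.1, 0 < s.2.2
    & s.1.1 * s.1.2 + s.2.1 * s.2.2 == n]%N.
Proof.
case: s => -[a x] [b y]; rewrite mem_filter /=; apply/andP/idP => [[/eqP e]|].
  move=> /allpairsP[[p r] /=]; rewrite !mem_rectangles => -[hp hr [? ?]]; subst p r.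
  by move: hp hr; rewrite /= => /andP[/andP[-> _] /andP[-> _]]
    /andP[/andP[-> _] /andP[-> _]]; rewrite e eqxx.
move=> /and5P[a0 x0 b0 y0 /eqP e]; split; first exact/eqP.
apply/allpairsP; exists ((a, x), (b, y)); rewrite !mem_rectangles /=.
by split=> //; nia.
Qed.

Lemma two_rectangles_uniq n : uniq (two_rectangles n).
Proof.
have uR : uniq (rectangles n).
  by apply: allpairs_uniq; rewrite ?iota_uniq // => -[? ?] [? ?] _ _ /= [-> ->].
by apply: filter_uniq; apply: allpairs_uniq => // -[? ?] [? ?] _ _ /= [-> ->].
Qed.

Section DivisorSums.
Variable V : comNzRingType.
Implicit Types (f g : nat -> V) (F H : nat -> nat -> V)
  (G : nat * nat * (nat * nat) -> V).

(* [divisors 0] is [[:: 1]]: the constant term has to be set apart. *)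
Definition divisor_series f : fps V :=
  FPS (fun n => if n == 0%N then 0 else \sum_(d <- divisors n) f d).

(** The box is fixed by [n] rather than by [k]: all coefficients up to [n] become sums over one
    index set, and the sums in a Cauchy product can be exchanged. *)
Lemma divisor_seriesE k n f : (k <= n)%N ->
  fcoef (divisor_series f) k
  = \sum_(p <- rectangles n | (p.1 * p.2 == k)%N) f p.1.
Proof.
move=> kn /=; case: posnP => [->|k0].
  rewrite big_seq_cond big_pred0 // => -[a x]; rewrite mem_rectangles muln_eq0 /=.
  by case: a x => [|a] [|x]; rewrite ?andbF.
rewrite (perm_big _ (perm_divisors k0)) /=.
rewrite -[RHS]big_filter.
rewrite -[RHS](big_map (fun p : nat * nat => p.1) predT f).
apply: perm_big; apply: uniq_perm; rewrite ?filter_uniq ?iota_uniq //.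
  rewrite map_inj_in_uniq ?filter_uniq //.
    by apply: allpairs_uniq; rewrite ?iota_uniq // => -[? ?] [? ?] _ _ /= [-> ->].
  move=> [a x] [b y]; rewrite !mem_filter !mem_rectangles /=.
  move=> /andP[/eqP <- /andP[/andP[a0 _] _]] /andP[/eqP + _] ab.
  by rewrite -ab => /eqP; rewrite eqn_pmul2l // => /eqP ->.
move=> d; rewrite mem_filter mem_iota; apply/idP/mapP => [/andP[dk h]|[[a x]]].
  exists (d, (k %/ d)%N); rewrite // mem_filter mem_rectangles /=.
  have := divnK dk; set q := (_ %/ _)%N; nia.
rewrite mem_filter mem_rectangles /= => /andP[/eqP e h] ->.
by rewrite -e dvdn_mulr //=; nia.
Qed.

Lemma coef_fpsM (f g : fps V) n :
  fcoef (f * g) n = \sum_(j < n.+1) fcoef f j * fcoef g (n - j).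
Proof. by []. Qed.

Lemma coef_divisor_seriesM n f g :
  fcoef (divisor_series f * divisor_series g) n
  = \sum_(s <- two_rectangles n) f s.1.1 * g s.2.1.
Proof.
rewrite big_filter big_mkcond big_allpairs [RHS]/=.
transitivity (\sum_(k < n.+1) \sum_(p <- rectangles n) \sum_(r <- rectangles n)
  (if (p.1 * p.2 == k)%N then f p.1 else 0)
  * (if (r.1 * r.2 == n - k)%N then g r.1 else 0)).
  rewrite coef_fpsM; apply: eq_bigr => k _.
  rewrite (divisor_seriesE (n := n) f (ltn_ord k)) (divisor_seriesE g (leq_subr k n)).
  by rewrite big_mkcond [in X in _ * X]big_mkcond big_distrlr.
rewrite exchange_big; apply: eq_big_seq => p; rewrite mem_rectangles => hp.
rewrite exchange_big; apply: eq_big_seq => r; rewrite mem_rectangles => hr /=.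
(* Only [k = p.1 * p.2] can contribute, and it does so exactly when the two areas add up to [n]. *)
case: eqP => e; last first.
  rewrite big1 // => k _; do 2!case: eqP => ?; rewrite ?(mul0r, mulr0) //.
  by case: e; have := ltn_ord k; lia.
have lt : (p.1 * p.2 < n.+1)%N by rewrite ltnS -e leq_addr.
rewrite (bigD1 (Ordinal lt)) //= eqxx -{1}e addKn eqxx big1 ?addr0 // => k /eqP nk.
case: eqP => ek; last by rewrite mul0r.
by case: nk; apply/val_inj; rewrite /= ek.
Qed.

(* The shear [(a, x), (b, y) |-> (a, x - y), (a + b, y)] preserves [a x + b y]. *)
Lemma sum_shear n F :
  \sum_(s <- two_rectangles n | (s.2.2 < s.1.2)%N) F s.1.1 (s.1.1 + s.2.1)%N
  = \sum_(s <- two_rectangles n | (s.1.1 < s.2.1)%N) F s.1.1 s.2.1.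
Proof.
pose t (s : nat * nat * (nat * nat)) :=
  ((s.1.1, (s.1.2 - s.2.2)%N), ((s.1.1 + s.2.1)%N, s.2.2)).
rewrite -big_filter -[RHS]big_filter.
rewrite -(big_map t predT (fun s => F s.1.1 s.2.1)).
apply: perm_big; apply: uniq_perm; rewrite ?(filter_uniq _ (two_rectangles_uniq n)) //.
  rewrite map_inj_in_uniq ?(filter_uniq _ (two_rectangles_uniq n)) //.
  move=> [[a x] [b y]] [[a' x'] [b' y']]; rewrite !mem_filter /= => /andP[xy _].
  by move=> /andP[xy' _] [-> e1 e2 e3]; congr (_, _, (_, _)); lia.
move=> [[a x] [b y]]; rewrite mem_filter mem_two_rectangles /=.
apply/mapP/idP => [[[[a' x'] [b' y']]]|h].
  rewrite mem_filter mem_two_rectangles /= => h [-> -> -> ->]; nia.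
exists ((a, (x + y)%N), ((b - a)%N, y)); last by congr (_, _, (_, _)) => /=; lia.
by rewrite mem_filter mem_two_rectangles /=; nia.
Qed.

Lemma sum_two_rectangles_swap n (P : pred (nat * nat * (nat * nat))) G :
  \sum_(s <- two_rectangles n | P s) G s
  = \sum_(s <- two_rectangles n | P (s.2, s.1)) G (s.2, s.1).
Proof.
pose t (s : nat * nat * (nat * nat)) := (s.2, s.1).
have tK : involutive t by case.
rewrite -(big_map t P G).
apply: perm_big; apply: uniq_perm; rewrite ?two_rectangles_uniq //.
  by rewrite (map_inj_uniq (inv_inj tK)) two_rectangles_uniq.
move=> s; rewrite -[s in RHS]tK (mem_map (inv_inj tK)).
by rewrite !mem_two_rectangles /=; nia.
Qed.

(** With [a = b = d] the equation reads [d * (x + y) = n]: [d] divides [n], and [x] takes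
    [n %/ d - 1] values, each of which determines [y]. *)
Lemma sum_equal_widths n F : (0 < n)%N ->
  \sum_(s <- two_rectangles n | s.1.1 == s.2.1) F s.1.1 s.2.1
  = \sum_(d <- divisors n) F d d *+ (n %/ d).-1.
Proof.
move=> n0; pose t (p : nat * nat) := ((p.1, p.2), (p.1, (n %/ p.1 - p.2)%N)).
pose D := [seq (d, x) | d <- divisors n, x <- iota 1 (n %/ d).-1].
transitivity (\sum_(p <- D) F p.1 p.1); last first.
  rewrite big_allpairs_dep /=; apply: eq_bigr => d _.
  by rewrite big_const_seq count_predT size_iota iter_addr_0.
have uD : uniq D.
  apply: allpairs_uniq_dep => [|? _|]; rewrite ?divisors_uniq ?iota_uniq //.
  by move=> [? ?] [? ?] _ _ /= [-> ->].
rewrite -big_filter -(big_map t predT (fun s => F s.1.1 s.2.1)).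
apply: perm_big; apply: uniq_perm.
- by rewrite filter_uniq ?two_rectangles_uniq.
- by rewrite map_inj_uniq // => -[? ?] [? ?] [-> ->].
move=> [[a x] [b y]]; rewrite mem_filter mem_two_rectangles /=.
apply/idP/mapP => [/andP[/eqP <-] /and5P[a0 x0 _ y0 /eqP e]|[[d z]]].
  have an : (a %| n)%N by rewrite -e -mulnDr dvdn_mulr.
  have ea : (n %/ a = x + y)%N by rewrite -e -mulnDr mulKn.
  exists (a, x); last by rewrite /t /= ea addKn.
  apply/allpairsPdep; exists a, x; rewrite -dvdn_divisors // mem_iota ea.
  by split=> //; lia.
move=> /allpairsPdep[d' [z' [+ + [? ?]]]] [? ? ? ?]; subst.
rewrite -dvdn_divisors // mem_iota => dn.
have := divnK dn; have := dvdn_gt0 n0 dn; set q := (_ %/ _)%N; nia.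
Qed.

(** With [x = y] the equation reads [(a + b) * x = n], so [d = a + b] divides [n] and [a] ranges
    over [1 <= a < d]. *)
Lemma sum_equal_heights n F : (0 < n)%N ->
  \sum_(s <- two_rectangles n | s.1.2 == s.2.2) F s.1.1 s.2.1
  = \sum_(d <- divisors n) \sum_(1 <= a < d) F a (d - a)%N.
Proof.
move=> n0.
pose t (p : nat * nat) := ((p.2, n %/ p.1)%N, ((p.1 - p.2)%N, (n %/ p.1)%N)).
pose D := [seq (d, a) | d <- divisors n, a <- index_iota 1 d].
transitivity (\sum_(p <- D) F p.2 (p.1 - p.2)%N); last first.
  by rewrite big_allpairs_dep.
have uD : uniq D.
  apply: allpairs_uniq_dep => [|? _|]; rewrite ?divisors_uniq ?iota_uniq //.
  by move=> [? ?] [? ?] _ _ /= [-> ->].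
rewrite -big_filter -(big_map t predT (fun s => F s.1.1 s.2.1)).
apply: perm_big; apply: uniq_perm.
- by rewrite filter_uniq ?two_rectangles_uniq.
- rewrite map_inj_in_uniq // => -[d a] [d' a'].
  move=> /allpairsPdep[? [? [_ + [? ?]]]] /allpairsPdep[? [? [_ + [? ?]]]]; subst.
  rewrite !mem_index_iota => h h2 [e _ e2 _]; congr pair; lia.
move=> [[a x] [b y]]; rewrite mem_filter mem_two_rectangles /=.
apply/idP/mapP => [/andP[/eqP <-] /and5P[a0 x0 b0 _ /eqP e]|[[d z]]].
  have an : ((a + b) %| n)%N by rewrite -e -mulnDl dvdn_mulr.
  have ea : (n %/ (a + b) = x)%N by rewrite -e -mulnDl mulKn // addn_gt0 a0.
  exists ((a + b)%N, a); last by rewrite /t /= ea addKn.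
  apply/allpairsPdep; exists (a + b)%N, a; rewrite -dvdn_divisors // mem_index_iota.
  by split=> //; lia.
move=> /allpairsPdep[d' [z' [+ + [? ?]]]] [? ? ? ?]; subst.
rewrite -dvdn_divisors // mem_index_iota => dn.
have := divnK dn; have := dvdn_gt0 n0 dn; set q := (_ %/ _)%N; nia.
Qed.

(** The hypotheses express the invariance of [H] under [(a, c) |-> (c, c - a)], with
    [F a b = H a (a + b)]. The shear and its mirror image match the terms of [F] with [x > y] and
    [x < y] to those of [H] with [a < b] and [a > b]; only the diagonals [x = y] and [a = b]
    survive. *)
Lemma sum_two_rectangles_invariant n F H : (0 < n)%N ->
  (forall a b, H a (a + b)%N = F a b) -> (forall a b, H (a + b)%N b = F a b) ->
  \sum_(s <- two_rectangles n) (F s.1.1 s.2.1 - H s.1.1 s.2.1)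
  = \sum_(d <- divisors n) \sum_(1 <= a < d) F a (d - a)%N
    - \sum_(d <- divisors n) H d d *+ (n %/ d).-1.
Proof.
move=> n0 H1 H2; rewrite sumrB.
rewrite [X in X - _](bigID (fun s => s.1.2 == s.2.2)) /= sum_equal_heights //.
rewrite [X in _ - X](bigID (fun s => s.1.1 == s.2.1)) /= sum_equal_widths //.
have split3 (P Q : nat * nat * (nat * nat) -> nat) (A : nat * nat * (nat * nat) -> V) :
    \sum_(s <- two_rectangles n | P s != Q s) A s
    = \sum_(s <- two_rectangles n | (Q s < P s)%N) A s
      + \sum_(s <- two_rectangles n | (P s < Q s)%N) A s.
  rewrite (bigID (fun s => Q s < P s)%N) /=; congr (_ + _).
    by apply: eq_bigl => s; case: ltngtP.
  by apply: eq_bigl => s; case: ltngtP.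
rewrite !split3.
have -> : \sum_(s <- two_rectangles n | (s.2.2 < s.1.2)%N) F s.1.1 s.2.1
    = \sum_(s <- two_rectangles n | (s.1.1 < s.2.1)%N) H s.1.1 s.2.1.
  by rewrite -sum_shear; apply: eq_bigr => s _; rewrite H1.
have -> : \sum_(s <- two_rectangles n | (s.1.2 < s.2.2)%N) F s.1.1 s.2.1
    = \sum_(s <- two_rectangles n | (s.2.1 < s.1.1)%N) H s.1.1 s.2.1.
  rewrite sum_two_rectangles_swap [RHS]sum_two_rectangles_swap /=.
  rewrite -(sum_shear n (fun a b => H b a)).
  by apply: eq_bigr => s _; rewrite -H2 addnC.
ring.
Qed.
End DivisorSums.

(** * Convolutions of divisor sums and Ramanujan's formulas *)

Section Convolutions.
Variable K : numFieldType.
Implicit Types (F H : K -> K -> K) (p e : K -> K).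

Definition sigma_series (k : nat) : fps K := divisor_series (fun d => d%:R ^+ k).

(** [p] is the closed form of the sum over [x = y]. On [a = b], writing [H d d = d * e d] turns
    [H d d * (n / d - 1)] into [n * e d - H d d]; the factor [n] is what becomes the derivative of a
    divisor series. *)
Lemma sum_invariant_polynomial n F H p e : (0 < n)%N ->
  (forall a b, H a (a + b) = F a b) -> (forall a b, H (a + b) b = F a b) ->
  (forall d, \sum_(1 <= a < d.+1) F a%:R (d.+1%:R - a%:R) = p d.+1%:R) ->
  (forall a, H a a = a * e a) ->
  \sum_(s <- two_rectangles n)
    (F s.1.1%:R s.2.1%:R - H s.1.1%:R s.2.1%:R)
  = \sum_(d <- divisors n) (p d%:R + H d%:R d%:R - n%:R * e d%:R).
Proof.
move=> n0 H1 H2 sumF He.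
rewrite (@sum_two_rectangles_invariant _ n (fun a b => F a%:R b%:R)
  (fun a b => H a%:R b%:R)) // => [|a b|a b]; rewrite ?natrD ?H1 ?H2 //.
rewrite -sumrB; apply: eq_big_seq => d; rewrite -dvdn_divisors // => dn.
have q0 : (0 < n %/ d)%N by rewrite divn_gt0 (dvdn_gt0 n0 dn, dvdn_leq n0 dn).
have -> : n%:R = d%:R * (n %/ d)%:R :> K by rewrite -natrM mulnC divnK.
rewrite -[H _ _ *+ _]mulr_natr -subn1 natrB // He.
case: d dn {q0} => [|d _]; first by rewrite dvd0n (gtn_eqF n0).
rewrite -sumF.
have -> : \sum_(1 <= a < d.+1) F a%:R (d.+1 - a)%:R
    = \sum_(1 <= a < d.+1) F a%:R (d.+1%:R - a%:R).
  by apply: eq_big_nat => a /andP[_ ad]; rewrite natrB // ltnW.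
ring.
Qed.

Lemma coef_sigma_seriesM n i j :
  fcoef (sigma_series i * sigma_series j) n
  = \sum_(s <- two_rectangles n) s.1.1%:R ^+ i * s.2.1%:R ^+ j.
Proof. exact: coef_divisor_seriesM. Qed.

Lemma coef_sigma_series n i : (0 < n)%N ->
  fcoef (sigma_series i) n = \sum_(d <- divisors n) d%:R ^+ i.
Proof. by case: n. Qed.

Lemma fps_nat_scale c (f : fps K) n : fcoef (c%:R * f) n = c%:R * fcoef f n.
Proof. by rewrite mulr_natl mulr_natl; elim: c => // c IH; rewrite !mulrS -IH. Qed.

Local Notation G := sigma_series.

Lemma coef0_sigma_seriesM i j : fcoef (G i * G j) 0 = 0.
Proof. by rewrite /= big_ord_recl big_ord0 mul0r addr0. Qed.

Lemma sigma_series_identity (A B : fps K) F H p e :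
  (forall a b, H a (a + b) = F a b) -> (forall a b, H (a + b) b = F a b) ->
  (forall d, \sum_(1 <= a < d.+1) F a%:R (d.+1%:R - a%:R) = p d.+1%:R) ->
  (forall a, H a a = a * e a) ->
  fcoef A 0 = fcoef B 0 ->
  (forall n, (0 < n)%N -> fcoef A n = \sum_(s <- two_rectangles n)
    (F s.1.1%:R s.2.1%:R - H s.1.1%:R s.2.1%:R)) ->
  (forall n, (0 < n)%N -> fcoef B n = \sum_(d <- divisors n)
    (p d%:R + H d%:R d%:R - n%:R * e d%:R)) ->
  A = B.
Proof.
move=> H1 H2 sumF He AB0 An Bn; apply/fpsP => n; case: (posnP n) => [->//|n0].
by rewrite An // Bn // (sum_invariant_polynomial n0 H1 H2 sumF He).
Qed.

Lemma coef_fpsD (f g : fps K) n : fcoef (f + g) n = fcoef f n + fcoef g n.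
Proof. by []. Qed.

Lemma coef_fpsN (f : fps K) n : fcoef (- f) n = - fcoef f n.
Proof. by []. Qed.

Lemma coef_fps_deriv (f : fps K) n : fcoef (fps_deriv f) n = n%:R * fcoef f n.
Proof. by []. Qed.

Definition coef_fpsE := (coef_fpsD, coef_fpsN, fps_nat_scale, coef_fps_deriv).

Lemma coef0_sigma_series i : fcoef (G i) 0 = 0.
Proof. by []. Qed.

(** Faulhaber's formulas, written in [N = m + 1] because the inner sums run over [1 <= a < d].
    Exponent 6 is reached for the product [G 1 * G 5]. *)
Lemma sum_powers m (N := m.+1%:R : K) :
  [/\ \sum_(1 <= a < m.+1) (1 : K) = N - 1,
   \sum_(1 <= a < m.+1) a%:R = N * (N - 1) / 2%:R :> K,
   \sum_(1 <= a < m.+1) a%:R ^+ 2 = N * (N - 1) * (2%:R * N - 1) / 6%:R :> K &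
   [/\ \sum_(1 <= a < m.+1) a%:R ^+ 3 = N ^+ 2 * (N - 1) ^+ 2 / 4%:R :> K,
    \sum_(1 <= a < m.+1) a%:R ^+ 4 =
      N * (N - 1) * (2%:R * N - 1) * (3%:R * N ^+ 2 - 3%:R * N - 1) / 30%:R :> K,
    \sum_(1 <= a < m.+1) a%:R ^+ 5 =
      N ^+ 2 * (N - 1) ^+ 2 * (2%:R * N ^+ 2 - 2%:R * N - 1) / 12%:R :> K &
    \sum_(1 <= a < m.+1) a%:R ^+ 6 = N * (N - 1) * (2%:R * N - 1)
      * (3%:R * N ^+ 4 - 6%:R * N ^+ 3 + 3%:R * N + 1) / 42%:R :> K]].
Proof.
rewrite {}/N; elim: m => [|m [IH0 IH1 IH2 [IH3 IH4 IH5 IH6]]].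
  by rewrite !big_geq //; split; [..|split]; field.
have n1 : m.+2%:R = m.+1%:R + 1 :> K by rewrite natr1.
split; [| | |split]; rewrite big_nat_recr //= ?IH0 ?IH1 ?IH2 ?IH3 ?IH4 ?IH5 ?IH6 ?n1;
  by field.
Qed.

(** The form [a^2 - a b + b^2] is invariant under [(a, c) |-> (c, c - a)]; with the factor 6,
    [F - H = 12 a b]. *)
Lemma sigma1_sigma1 :
  12%:R * (G 1 * G 1) = 5%:R * G 3 + G 1 - 6%:R * fps_deriv (G 1).
Proof.
apply: (@sigma_series_identity _ _
  (fun a b => 6%:R * (a ^+ 2 + a * b + b ^+ 2))
  (fun a b => 6%:R * (a ^+ 2 - a * b + b ^+ 2))
  (fun d => 5%:R * d ^+ 3 - 6%:R * d ^+ 2 + d) (fun d => 6%:R * d)).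
- by move=> a b; ring.
- by move=> a b; ring.
- move=> d; have [S0 S1 S2 _] := sum_powers d.
  transitivity (6%:R * (d.+1%:R ^+ 2 * \sum_(1 <= a < d.+1) (1 : K)
    - d.+1%:R * \sum_(1 <= a < d.+1) a%:R + \sum_(1 <= a < d.+1) a%:R ^+ 2)).
    rewrite !mulr_sumr -sumrB -big_split mulr_sumr /=.
    by apply: eq_bigr => a _; ring.
  by rewrite S0 S1 S2; field.
- by move=> a; ring.
- by rewrite !coef_fpsE !coef0_sigma_seriesM !coef0_sigma_series; ring.
- move=> n n0; rewrite !coef_fpsE !coef_sigma_seriesM mulr_sumr.
  by apply: eq_bigr => s _; ring.
- move=> n n0; rewrite !coef_fpsE !coef_sigma_series //.
  rewrite !mulr_sumr -big_split -sumrB /=.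
  by apply: eq_bigr => d _; ring.
Qed.

(** The square of the same form gives [F - H = 120 (a^3 b + a b^3)], whence the symmetrised product
    in the proof. *)
Lemma sigma1_sigma3 :
  240%:R * (G 1 * G 3) = 21%:R * G 5 + 10%:R * G 3 - 30%:R * fps_deriv (G 3) - G 1.
Proof.
apply: (@sigma_series_identity _ _
  (fun a b => 30%:R * (a ^+ 2 + a * b + b ^+ 2) ^+ 2)
  (fun a b => 30%:R * (a ^+ 2 - a * b + b ^+ 2) ^+ 2)
  (fun d => 21%:R * d ^+ 5 - 30%:R * d ^+ 4 + 10%:R * d ^+ 3 - d)
  (fun d => 30%:R * d ^+ 3)).
- by move=> a b; ring.
- by move=> a b; ring.
- move=> d; have [S0 S1 S2 [S3 S4 _ _]] := sum_powers d.
  pose D : K := d.+1%:R.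
  transitivity (30%:R * (D ^+ 4 * \sum_(1 <= a < d.+1) (1 : K)
    - 2%:R * D ^+ 3 * \sum_(1 <= a < d.+1) a%:R
    + 3%:R * D ^+ 2 * \sum_(1 <= a < d.+1) a%:R ^+ 2
    - 2%:R * D * \sum_(1 <= a < d.+1) a%:R ^+ 3
    + \sum_(1 <= a < d.+1) a%:R ^+ 4)).
    rewrite !mulr_sumr -!(sumrB, big_split) mulr_sumr /=.
    by apply: eq_bigr => a _; rewrite -/D; ring.
  by rewrite S0 S1 S2 S3 S4 -/D; field.
- by move=> a; ring.
- by rewrite !coef_fpsE !coef0_sigma_seriesM !coef0_sigma_series; ring.
- move=> n n0; have -> : 240%:R * (G 1 * G 3) = 120%:R * (G 1 * G 3 + G 3 * G 1).
    by ring.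
  rewrite !coef_fpsE !coef_sigma_seriesM -big_split mulr_sumr.
  by apply: eq_bigr => s _ /=; ring.
- move=> n n0; rewrite !coef_fpsE !coef_sigma_series //.
  rewrite !mulr_sumr -!(sumrB, big_split) /=.
  by apply: eq_bigr => d _; ring.
Qed.

(** [(a b (b - a))^2] is invariant under the same map and gives [F - H = 120 a^3 b^3]. It is 0 at
    [a = b], so no derivative appears. *)
Lemma sigma3_sigma3 : 120%:R * (G 3 * G 3) = G 7 - G 3.
Proof.
apply: (@sigma_series_identity _ _
  (fun a b => 30%:R * (a * b * (a + b)) ^+ 2)
  (fun a b => 30%:R * (a * b * (b - a)) ^+ 2)
  (fun d => d ^+ 7 - d ^+ 3) (fun d => 0)).
- by move=> a b; ring.
- by move=> a b; ring.
- move=> d; have [_ _ S2 [S3 S4 _ _]] := sum_powers d.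
  pose D : K := d.+1%:R.
  transitivity (30%:R * D ^+ 2 * (D ^+ 2 * \sum_(1 <= a < d.+1) a%:R ^+ 2
    - 2%:R * D * \sum_(1 <= a < d.+1) a%:R ^+ 3
    + \sum_(1 <= a < d.+1) a%:R ^+ 4)).
    rewrite !mulr_sumr -!(sumrB, big_split) mulr_sumr /=.
    by apply: eq_bigr => a _; rewrite -/D; ring.
  by rewrite S2 S3 S4 -/D; field.
- by move=> a; ring.
- by rewrite !coef_fpsE !coef0_sigma_seriesM !coef0_sigma_series; ring.
- move=> n n0; rewrite !coef_fpsE !coef_sigma_seriesM mulr_sumr.
  by apply: eq_bigr => s _ /=; ring.
- move=> n n0; rewrite !coef_fpsE !coef_sigma_series //.
  rewrite -sumrB /=.
  by apply: eq_bigr => d _; ring.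
Qed.

Lemma fps_mulnI c (f g : fps K) : (0 < c)%N -> c%:R * f = c%:R * g -> f = g.
Proof.
move=> c0 e; apply/fpsP => n; apply/(mulfI (x := c%:R)); rewrite ?pnatr_eq0 -?lt0n //.
by rewrite -!fps_nat_scale e.
Qed.

(** The cube of [a^2 - a b + b^2] gives [F - H = 2520 (a^5 b + a b^5) + 5880 a^3 b^3]; the last
    term, where [5880 = 49 * 120], is removed by [sigma3_sigma3]. *)
Lemma sigma1_sigma5 :
  504%:R * (G 1 * G 5) = 20%:R * G 7 + 21%:R * G 5 - 42%:R * fps_deriv (G 5) + G 1.
Proof.
suff e : 2520%:R * (G 1 * G 5 + G 5 * G 1) + 49%:R * (120%:R * (G 3 * G 3))
    = 249%:R * G 7 + 210%:R * G 5 - 49%:R * G 3 + 10%:R * G 1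
      - 420%:R * fps_deriv (G 5).
  apply: (@fps_mulnI 10) => //.
  have -> : 10%:R * (504%:R * (G 1 * G 5)) =
    2520%:R * (G 1 * G 5 + G 5 * G 1) + 49%:R * (120%:R * (G 3 * G 3))
      - 49%:R * (120%:R * (G 3 * G 3)).
    by ring.
  by rewrite [X in _ + _ - _ * X]sigma3_sigma3 [X in X - _]e; ring.
apply: (@sigma_series_identity _ _
  (fun a b => 420%:R * (a ^+ 2 + a * b + b ^+ 2) ^+ 3)
  (fun a b => 420%:R * (a ^+ 2 - a * b + b ^+ 2) ^+ 3)
  (fun d => 249%:R * d ^+ 7 - 420%:R * d ^+ 6 + 210%:R * d ^+ 5 - 49%:R * d ^+ 3
    + 10%:R * d)
  (fun d => 420%:R * d ^+ 5)).
- by move=> a b; ring.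
- by move=> a b; ring.
- move=> d; have [S0 S1 S2 [S3 S4 S5 S6]] := sum_powers d.
  pose D : K := d.+1%:R.
  transitivity (420%:R * (D ^+ 6 * \sum_(1 <= a < d.+1) (1 : K)
    - 3%:R * D ^+ 5 * \sum_(1 <= a < d.+1) a%:R
    + 6%:R * D ^+ 4 * \sum_(1 <= a < d.+1) a%:R ^+ 2
    - 7%:R * D ^+ 3 * \sum_(1 <= a < d.+1) a%:R ^+ 3
    + 6%:R * D ^+ 2 * \sum_(1 <= a < d.+1) a%:R ^+ 4
    - 3%:R * D * \sum_(1 <= a < d.+1) a%:R ^+ 5
    + \sum_(1 <= a < d.+1) a%:R ^+ 6)).
    rewrite !mulr_sumr -!(sumrB, big_split) mulr_sumr /=.
    by apply: eq_bigr => a _; rewrite -/D; ring.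
  by rewrite S0 S1 S2 S3 S4 S5 S6 -/D; field.
- by move=> a; ring.
- by rewrite !coef_fpsE !coef0_sigma_seriesM !coef0_sigma_series; ring.
- move=> n n0.
  rewrite !coef_fpsE !coef_sigma_seriesM -big_split !mulr_sumr -big_split.
  by apply: eq_bigr => s _ /=; ring.
- move=> n n0; rewrite !coef_fpsE !coef_sigma_series //.
  rewrite !mulr_sumr -!(sumrB, big_split) /=.
  by apply: eq_bigr => d _; ring.
Qed.

(** * The Eisenstein series and Ramanujan's formulas *)

Local Notation E2 := (E2 K).
Local Notation E4 := (E4 K).
Local Notation E6 := (E6 K).

Lemma sum_natrX_divisors k n : (sigma k n)%:R = \sum_(d <- divisors n) d%:R ^+ k :> K.
Proof. by rewrite natr_sum; apply: eq_bigr => d _; rewrite natrX. Qed.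

Lemma E2_sigma_series : E2 = 1 - 24%:R * G 1.
Proof.
apply/fpsP => n; rewrite !coef_fpsE /= sum_natrX_divisors.
by case: n => [|n] /=; ring.
Qed.

Lemma E4_sigma_series : E4 = 1 + 240%:R * G 3.
Proof.
apply/fpsP => n; rewrite !coef_fpsE /= sum_natrX_divisors.
by case: n => [|n] /=; ring.
Qed.

Lemma E6_sigma_series : E6 = 1 - 504%:R * G 5.
Proof.
apply/fpsP => n; rewrite !coef_fpsE /= sum_natrX_divisors.
by case: n => [|n] /=; ring.
Qed.

Lemma fps_derivD (f g : fps K) : fps_deriv (f + g) = fps_deriv f + fps_deriv g.
Proof. by apply/fpsP => n; rewrite !coef_fpsE mulrDr. Qed.

Lemma fps_derivN (f : fps K) : fps_deriv (- f) = - fps_deriv f.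
Proof. by apply/fpsP => n; rewrite !coef_fpsE mulrN. Qed.

Lemma fps_derivM (f g : fps K) :
  fps_deriv (f * g) = fps_deriv f * g + f * fps_deriv g.
Proof.
apply/fpsP => n; rewrite coef_fpsD !coef_fpsM coef_fps_deriv coef_fpsM mulr_sumr.
rewrite -big_split; apply: eq_bigr => k _ /=.
rewrite -{1}(subnK (_ : k <= n)%N) -1?ltnS // natrD; ring.
Qed.

Lemma fps_deriv_nat c : fps_deriv (c%:R : fps K) = 0.
Proof.
apply/fpsP => n; rewrite coef_fps_deriv -[c%:R]mulr1 fps_nat_scale /=.
by case: n => [|n]; rewrite ?mul0r ?mulr0.
Qed.

Lemma fps_deriv1 : fps_deriv (1 : fps K) = 0.
Proof. exact: (fps_deriv_nat 1). Qed.

Definition fps_derivE :=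
  (fps_derivD, fps_derivN, fps_derivM, fps_deriv_nat, fps_deriv1).

Lemma ramanujan_E2 : 12%:R * fps_deriv E2 = E2 ^+ 2 - E4.
Proof.
rewrite E2_sigma_series E4_sigma_series !fps_derivE.
have -> : (1 - 24%:R * G 1) ^+ 2 = 1 - 48%:R * G 1 + 48%:R * (12%:R * (G 1 * G 1)).
  by ring.
by rewrite sigma1_sigma1; ring.
Qed.

Lemma ramanujan_E4 : 3%:R * fps_deriv E4 = E2 * E4 - E6.
Proof.
rewrite E2_sigma_series E4_sigma_series E6_sigma_series !fps_derivE.
have -> : (1 - 24%:R * G 1) * (1 + 240%:R * G 3)
  = 1 - 24%:R * G 1 + 240%:R * G 3 - 24%:R * (240%:R * (G 1 * G 3)) by ring.
by rewrite [X in _ + _ - _ * X - _]sigma1_sigma3; ring.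
Qed.

(** [G 7] enters [E2 * E6] with coefficient [24 * 20] and [E4 ^+ 2] with coefficient 480, so it
    cancels. *)
Lemma ramanujan_E6 : 2%:R * fps_deriv E6 = E2 * E6 - E4 ^+ 2.
Proof.
rewrite E2_sigma_series E4_sigma_series E6_sigma_series !fps_derivE.
have -> : (1 - 24%:R * G 1) * (1 - 504%:R * G 5)
  = 1 - 24%:R * G 1 - 504%:R * G 5 + 24%:R * (504%:R * (G 1 * G 5)) by ring.
have -> : (1 + 240%:R * G 3) ^+ 2 = 1 + 480%:R * G 3 + 480%:R * (120%:R * (G 3 * G 3)).
  by ring.
rewrite [X in _ - (1 + _ + _ * X)]sigma3_sigma3 [X in _ - _ + _ * X - _]sigma1_sigma5.
ring.
Qed.
End Convolutions.

(** * Order of vanishing *)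

Section Vanishing.
Variable K : numFieldType.
Implicit Types (f g h : fps K) (m n : nat).

Definition vanishes n f := forall i, (i < n)%N -> fcoef f i = 0.

Lemma vanishesW m n f : (m <= n)%N -> vanishes n f -> vanishes m f.
Proof. by move=> mn fn i im; apply: fn; apply: leq_trans im mn. Qed.

Lemma vanishesS n f : vanishes n f -> fcoef f n = 0 -> vanishes n.+1 f.
Proof. by move=> fn f0 i; rewrite ltnS leq_eqVlt => /predU1P[->|/fn]. Qed.

Lemma vanishesB n f g : vanishes n f -> vanishes n g -> vanishes n (f - g).
Proof. by move=> fn gn i i_n; rewrite coef_fpsD coef_fpsN fn ?gn // subr0. Qed.

Lemma vanishesMr n f g : vanishes n f -> vanishes n (f * g).
Proof.
move=> fn i i_n; rewrite coef_fpsM big1 // => j _.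
by rewrite fn ?mul0r // (leq_ltn_trans _ i_n) // -ltnS.
Qed.

Lemma vanishesMl n f g : vanishes n f -> vanishes n (g * f).
Proof. by rewrite mulrC; apply: vanishesMr. Qed.

Lemma coef_vanishesM m n f g : vanishes m f -> vanishes n g ->
  fcoef (f * g) (m + n) = fcoef f m * fcoef g n.
Proof.
move=> fm gn; rewrite coef_fpsM.
have lt : (m < (m + n).+1)%N by rewrite ltnS leq_addr.
rewrite (bigD1 (Ordinal lt)) //= addKn big1 ?addr0 // => j /eqP jm.
case: (ltngtP j m) => [/fm->|mj|e]; rewrite ?mul0r //; last first.
  by case: jm; apply: val_inj.
by rewrite gn ?mulr0 //; have := ltn_ord j; lia.
Qed.

Lemma coef_vanishesMr n f g : vanishes n f ->
  fcoef (f * g) n = fcoef f n * fcoef g 0.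
Proof. by move=> fn; rewrite -{1}[n]addn0 coef_vanishesM. Qed.

Lemma coef_vanishesMl n f g : vanishes n f ->
  fcoef (g * f) n = fcoef g 0 * fcoef f n.
Proof. by move=> fn; rewrite mulrC coef_vanishesMr // mulrC. Qed.

Lemma coef0M f g : fcoef (f * g) 0 = fcoef f 0 * fcoef g 0.
Proof. exact: coef_vanishesMr. Qed.

Lemma coef0X f n : fcoef (f ^+ n) 0 = fcoef f 0 ^+ n.
Proof. by elim: n => // n IH; rewrite !exprS coef0M IH. Qed.

Lemma vanishes_div m n f g : vanishes m f -> fcoef f m != 0 ->
  vanishes (m + n) (f * g) -> vanishes n g.
Proof.
move=> fm fm0; elim: n => // n IH; rewrite addnS => fg.
have gn : vanishes n g by apply: IH; apply: vanishesW fg.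
apply: vanishesS => //; apply/(mulfI fm0); rewrite mulr0 -coef_vanishesM //.
exact: fg.
Qed.

Lemma vanishes_mul_eq0 m f g : vanishes m f -> fcoef f m != 0 -> f * g = 0 -> g = 0.
Proof.
move=> fm fm0 fg0; apply/fpsP => n.
by apply: (@vanishes_div m n.+1 f g) => //; rewrite fg0.
Qed.

Lemma vanishesX n f : vanishes 1 f ->
  vanishes n (f ^+ n) /\ fcoef (f ^+ n) n = fcoef f 1 ^+ n.
Proof.
move=> f1; elim: n => [|n [IH1 IH2]]; first by split=> //.
have c : fcoef (f ^+ n.+1) n.+1 = fcoef f 1 ^+ n.+1.
  by rewrite !exprS -add1n coef_vanishesM // IH2.
split=> // i; rewrite ltnS leq_eqVlt => /predU1P[->|i_n]; last first.
  by rewrite exprS (vanishesMl f IH1).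
by rewrite exprS coef_vanishesMl // f1 // mul0r.
Qed.

(** The coefficients of index below [n] of the [v j] form a triangular matrix with nonzero diagonal.
    It factors through the [m] coordinates in a basis, so its rank [n] is at most [m]. *)
Lemma has_dim_vanishes (V : set (fps K)) m n (v : nat -> fps K) :
  has_dim V m -> (forall j, (j < n)%N -> V (v j)) ->
  (forall j, (j < n)%N -> vanishes j (v j) /\ fcoef (v j) j != 0) -> (n <= m)%N.
Proof.
move=> [e [_ ->]] Vv ord_v.
have /choice[c vE] : forall j : 'I_n, exists c : 'I_m -> K, v j = \sum_i c i *: e i.
  by move=> j; apply: Vv.
pose A : 'M[K]_(n, m) := \matrix_(j, i) c j i.
pose B : 'M[K]_(m, n) := \matrix_(i, k) fcoef (e i) k.
have coef_sum k (F : 'I_m -> fps K) : fcoef (\sum_i F i) k = \sum_i fcoef (F i) k.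
  exact: (big_morph (fun f => fcoef f k)).
have AB j k : (A *m B) j k = fcoef (v j) k.
  by rewrite mxE vE coef_sum; apply: eq_bigr => i _; rewrite !mxE.
have unitAB : (A *m B)^T \in unitmx.
  rewrite unitmxE det_trig.
    rewrite unitfE; apply/prodf_neq0 => j _; rewrite mxE AB.
    by have [] := ord_v j (ltn_ord j).
  apply/is_trig_mxP => j k jk; rewrite mxE AB.
  by have [vk _] := ord_v k (ltn_ord k); apply: vk.
rewrite unitmx_tr in unitAB; rewrite -(mxrank_unit unitAB).
exact: mulmx_max_rank.
Qed.
End Vanishing.

(** * Quasimodular forms of depth at most one *)

Section QuasimodularForms.
Variable K : numFieldType.
Implicit Types (f g h : fps K) (s t : nat) (w v : int).
Local Notation E2 := (E2 K).
Local Notation E4 := (E4 K).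
Local Notation E6 := (E6 K).

(* With weights in [int], subtracting 12 from a weight is never truncated. *)
Inductive qmf s : int -> fps K -> Prop :=
| qmf_zero w : qmf s w 0
| qmf_monomial w a b c x : (a <= s)%N -> w = (2 * a + 4 * b + 6 * c)%N ->
    qmf s w (x *: (E2 ^+ a * E4 ^+ b * E6 ^+ c))
| qmf_add w f g : qmf s w f -> qmf s w g -> qmf s w (f + g).

Lemma qmfZ s w x f : qmf s w f -> qmf s w (x *: f).
Proof.
elim=> [v|v a b c y a_s ->|v g h _ IHg _ IHh].
- by rewrite scaler0; apply: qmf_zero.
- by rewrite scalerA; apply: qmf_monomial.
- by rewrite scalerDr; apply: qmf_add.
Qed.

Lemma qmfN s w f : qmf s w f -> qmf s w (- f).
Proof. by rewrite -scaleN1r; apply: qmfZ. Qed.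

Lemma qmfB s w f g : qmf s w f -> qmf s w g -> qmf s w (f - g).
Proof. by move=> qf /qmfN; apply: qmf_add. Qed.

Lemma qmfM s t w v f g : qmf s w f -> qmf t v g -> qmf (s + t) (w + v) (f * g).
Proof.
move=> qf qg; elim: qf => [u|u a b c x a_s eu|u f1 f2 _ IH1 _ IH2].
- by rewrite mul0r; apply: qmf_zero.
- elim: qg => [u'|u' a' b' c' x' a'_t eu'|u' g1 g2 _ IH1 _ IH2].
  + by rewrite mulr0; apply: qmf_zero.
  + rewrite -scalerAl -scalerAr scalerA.
    have -> : E2 ^+ a * E4 ^+ b * E6 ^+ c * (E2 ^+ a' * E4 ^+ b' * E6 ^+ c')
      = E2 ^+ (a + a') * E4 ^+ (b + b') * E6 ^+ (c + c') by rewrite !exprD; ring.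
    by apply: qmf_monomial; [apply: leq_add | rewrite eu eu'; lia].
  + by rewrite mulrDr; apply: qmf_add.
- by rewrite mulrDl; apply: qmf_add.
Qed.

Lemma qmf1 : qmf 0 0 1.
Proof. by have := @qmf_monomial 0 0 0 0 0 1 isT erefl; rewrite !mul1r scale1r. Qed.

Lemma qmf_E2 : qmf 1 2 E2.
Proof.
by have := @qmf_monomial 1 2 1 0 0 1 isT erefl; rewrite expr1 !mulr1 scale1r.
Qed.

Lemma qmf_E4 : qmf 0 4 E4.
Proof.
by have := @qmf_monomial 0 4 0 1 0 1 isT erefl; rewrite expr1 mulr1 mul1r scale1r.
Qed.

Lemma qmf_E6 : qmf 0 6 E6.
Proof.
by have := @qmf_monomial 0 6 0 0 1 1 isT erefl; rewrite expr1 !mul1r scale1r.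
Qed.

Lemma qmf_nat s w c f : qmf s w f -> qmf s w (c%:R * f).
Proof. by rewrite -scaler_nat -scalerAl mul1r; apply: qmfZ. Qed.

Lemma mnm3_mon (a b c : nat) (m := [multinom [tuple a; b; c]]) :
  [/\ m ord0 = a, qm_weight m = (2 * a + 4 * b + 6 * c)%N &
    mmap1 (tnth [tuple E2; E4; E6]) m = E2 ^+ a * E4 ^+ b * E6 ^+ c].
Proof.
split; first by rewrite multinomE (tnth_nth 0%N).
  rewrite /qm_weight !big_ord_recl big_ord0 !multinomE !(tnth_nth 0%N) /=.
  lia.
rewrite /mmap1 !big_ord_recl big_ord0 mulr1 mulrA.
by rewrite !multinomE !(tnth_nth 0%N) !(tnth_nth 0).
Qed.

Lemma eval_E_qmf s (w : nat) (P : {mpoly K[3]}) : P \is w.-homog for qm_weight ->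
  {in msupp P, forall m : 'X_{1..3}, (m ord0 <= s)%N} -> qmf s w (eval_E P).
Proof.
move=> /dhomogP Pw Ps; rewrite /eval_E /mmap big_seq.
apply: big_ind => [|f g|m mP]; [exact: qmf_zero | exact: qmf_add |].
have mE : m = [multinom [tuple m ord0; m (inord 1); m (inord 2)]].
  apply/mnmP => i; rewrite multinomE (tnth_nth 0%N).
  by case: i => -[|[|[|//]]] i /=; congr (m _); apply/val_inj; rewrite /= ?inordK.
have := mnm3_mon (m ord0) (m (inord 1)) (m (inord 2)); rewrite -mE => -[_ mw ->].
by rewrite mulr_algl; apply: qmf_monomial; rewrite ?Ps // -mw Pw.
Qed.

Lemma qmf_quasimodular s (w : nat) f : qmf s w f -> quasimodular w s f.
Proof.
suff H v : qmf s v f -> v = w -> quasimodular w s f by move/H; apply.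
elim=> {v f} [v _|v a b c x a_s -> [ew]|v f g _ IHf _ IHg ev].
- exists 0; split; [exact: rpred0 | by rewrite msupp0 | by rewrite /eval_E mmap0].
- have [m0 mw mE] := mnm3_mon a b c.
  exists (x *: 'X_[[multinom [tuple a; b; c]]]); split.
  + by apply: dhomogZ; rewrite dhomogX; apply/eqP; rewrite -ew -mw.
  + by move=> m /msuppZ_le /mem_msuppXP <-; rewrite m0.
  + by rewrite /eval_E mmapZ mmapX mE mulr_algl.
- have [P [Pw Ps ->]] := IHf ev; have [Q [Qw Qs ->]] := IHg ev.
  exists (P + Q); split; [exact: rpredD | | by rewrite /eval_E mmapD].
  by move=> m /msuppD_le; rewrite mem_cat => /orP[/Ps|/Qs].
Qed.

Lemma quasimodular_qmf s (w : nat) f : quasimodular w s f -> qmf s w f.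
Proof. by move=> [P [Pw Ps ->]]; apply: eval_E_qmf => // m /Ps. Qed.

Lemma qmf_depth1 w f : qmf 1 w f ->
  exists A B, [/\ qmf 0 w A, qmf 0 (w - 2) B & f = A + B * E2].
Proof.
elim=> [v|v a b c x|v g h _ [A [B [qA qB ->]]] _ [A' [B' [qA' qB' ->]]]].
- by exists 0, 0; rewrite mul0r addr0; split=> //; apply: qmf_zero.
- case: a => [|[|//]] _ ->.
    exists (x *: (E2 ^+ 0 * E4 ^+ b * E6 ^+ c)), 0; split; last by rewrite mul0r addr0.
      exact: qmf_monomial.
    exact: qmf_zero.
  exists 0, (x *: (E2 ^+ 0 * E4 ^+ b * E6 ^+ c)); split; first exact: qmf_zero.
    by apply: qmf_monomial => //; lia.
  by rewrite add0r -scalerAl; congr (_ *: _); ring.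
- exists (A + A'), (B + B'); split; [exact: qmf_add | exact: qmf_add | ring].
Qed.

(* The discriminant up to the factor 1728. *)
Definition disc : fps K := E4 ^+ 3 - E6 ^+ 2.

Lemma vanishes_disc : vanishes 1 disc.
Proof. by case=> // _; rewrite coef_fpsD coef_fpsN !coef0X /= !expr1n subrr. Qed.

Lemma coef1_disc : fcoef disc 1 != 0.
Proof.
have c1 f : fcoef (f * f) 1 = 2%:R * fcoef f 0 * fcoef f 1.
  by rewrite coef_fpsM !big_ord_recl big_ord0 /=; ring.
have c1' f g : fcoef (f * g) 1 = fcoef f 0 * fcoef g 1 + fcoef f 1 * fcoef g 0.
  by rewrite coef_fpsM !big_ord_recl big_ord0 /=; ring.
rewrite /disc coef_fpsD coef_fpsN !exprS expr0 !mulr1 c1' !c1 coef0M /=.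
have -> : sigma 3 1 = 1%N by rewrite /sigma big_seq1.
have -> : sigma 5 1 = 1%N by rewrite /sigma big_seq1.
(* The coefficient is [3 * 240 + 2 * 504]. *)
rewrite (_ : _ - _ = 1728%:R) ?pnatr_eq0 //; ring.
Qed.

Lemma vanishes_discX n : vanishes n (disc ^+ n) /\ fcoef (disc ^+ n) n != 0.
Proof.
have [? ->] := vanishesX n vanishes_disc.
by split=> //; rewrite expf_neq0 // coef1_disc.
Qed.

(* A monomial [E4 ^+ a * E6 ^+ b] with [b <= 1] of weight [w], when there is one. *)
Definition E46 w : fps K :=
  E4 ^+ ((`|w| - 6 * odd (`|w|./2)) %/ 4) * E6 ^+ odd (`|w|./2).

Lemma coef0_E46 w : fcoef (E46 w) 0 = 1.
Proof. by rewrite coef0M !coef0X /= !expr1n mulr1. Qed.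

(** Replacing [E6 ^+ 2] by [E4 ^+ 3 - disc] lowers the exponent of [E6] by two modulo [disc]; once
    it is 0 or 1, the weight fixes the monomial. *)
Lemma modular_reduce w f : qmf 0 w f ->
  exists x g, f = x *: E46 w + disc * g /\ qmf 0 (w - 12) g.
Proof.
elim=> [v|v a b c x|v f1 f2 _ [x [g [-> qg]]] _ [y [h [-> qh]]]].
- by exists 0, 0; rewrite scale0r mulr0 addr0; split=> //; apply: qmf_zero.
- rewrite leqn0 => /eqP -> ->; rewrite mul1r {v}.
  have [n] := ubnP c; elim: n c b => // n IH [|[|c]] b c_n.
  + exists x, 0; split; last exact: qmf_zero.
    by rewrite mulr0 addr0 /E46; congr (_ *: (_ ^+ _ * _ ^+ _)); lia.
  + exists x, 0; split; last exact: qmf_zero.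
    by rewrite mulr0 addr0 /E46; congr (_ *: (_ ^+ _ * _ ^+ _)); lia.
  have [|y [g [e qg]]] := IH c (b + 3)%N; first by lia.
  have ew : (2 * 0 + 4 * (b + 3) + 6 * c = 2 * 0 + 4 * b + 6 * c.+2)%N by lia.
  rewrite ew in e qg.
  exists y, (g - x *: (E2 ^+ 0 * E4 ^+ b * E6 ^+ c)); split; last first.
    by apply: qmfB => //; apply: qmf_monomial => //; lia.
  rewrite mulrBr addrA -e -scalerAr -scalerBr; congr (_ *: _).
  by rewrite /disc exprD !exprS; ring.
- exists (x + y), (g + h); split; last exact: qmf_add.
  by rewrite scalerDl; ring.
Qed.

(** [4 b + 6 c] is never negative and never 2. *)
Lemma modular_no_weight w f : qmf 0 w f -> w < 0 \/ w = 2 -> f = 0.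
Proof.
by elim=> // [v a b c x| v g h _ IHg _ IHh /[dup]/IHg -> /IHh ->];
  [lia | rewrite addr0].
Qed.

Lemma modular_weight0 f : qmf 0 0 f -> exists x, f = x *: 1.
Proof.
move=> /modular_reduce[x [g [-> /modular_no_weight ->]]]; last by left.
by exists x; rewrite mulr0 addr0 /E46 /= mulr1.
Qed.

(** If [disc ^+ n * g] vanishes to order [n + 1], then [g] has constant term 0. As [E46] has
    constant term 1, [modular_reduce] then makes [g] divisible by [disc]. *)
Lemma modular_vanishes n w f : qmf 0 w f -> vanishes n f ->
  exists g, f = disc ^+ n * g /\ qmf 0 (w - (12 * n)%:Z) g.
Proof.
move=> qf; elim: n => [_|n IH fn].
  by exists f; rewrite mul1r muln0 subr0.
have [g [fE /modular_reduce[x [h [gE qh]]]]] := IH (vanishesW (leqnSn n) fn).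
have [vn dn] := vanishes_discX n.
have g0 : fcoef g 0 = 0.
  by apply: (@vanishes_div _ n 1 _ _ vn dn) => //; rewrite -fE addn1.
have x0 : x = 0.
  move: g0; rewrite gE coef_fpsD coef0M (vanishes_disc (ltnSn 0)) mul0r addr0.
  have -> : fcoef (x *: E46 (w - (12 * n)%:Z)) 0 = x * fcoef (E46 (w - (12 * n)%:Z)) 0.
    by [].
  by rewrite coef0_E46 mulr1.
exists h; split; first by rewrite fE gE x0 scale0r add0r exprSr mulrA.
by rewrite mulnS; have -> : w - (12 + 12 * n)%:Z = w - (12 * n)%:Z - 12 by lia.
Qed.

End QuasimodularForms.

(** * The extremal forms of weights [6 n] and [6 n + 2] *)

(* The identities below are stated over an abstract ring, where [ring] and
   rewriting do not unfold the operations of power series. *)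
Section ExtremalStep.
Variable A : comNzRingType.

(* [c] stands for [6 * n]. *)
Lemma deriv_step_fst (c e2 e4 e6 d4 d6 p q dp dq : A) :
  3%:R * d4 = e2 * e4 - e6 -> 2%:R * d6 = e2 * e6 - e4 ^+ 2 ->
  12%:R * dp = (c - 1) * (e2 * p) + (c + 1) * q ->
  12%:R * dq = (c + 1) * (e2 * q) + (c - 1) * (e4 * p) ->
  12%:R * ((d4 * q + e4 * dq) - (d6 * p + e6 * dp))
  = (c + 5%:R) * (e2 * (e4 * q - e6 * p) + (e4 ^+ 2 * p - e6 * q)).
Proof.
move=> h4 h6 hp hq.
transitivity (4%:R * (3%:R * d4) * q + e4 * (12%:R * dq)
  - 6%:R * (2%:R * d6) * p - e6 * (12%:R * dp)); first by ring.
by rewrite h4 h6 hp hq; ring.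
Qed.

Lemma deriv_step_snd (c e2 e4 e6 d4 d6 p q dp dq : A) :
  3%:R * d4 = e2 * e4 - e6 -> 2%:R * d6 = e2 * e6 - e4 ^+ 2 ->
  12%:R * dp = (c - 1) * (e2 * p) + (c + 1) * q ->
  12%:R * dq = (c + 1) * (e2 * q) + (c - 1) * (e4 * p) ->
  12%:R * ((2%:R * (e4 * d4) * p + e4 ^+ 2 * dp) - (d6 * q + e6 * dq))
  = (c + 7%:R) * (e2 * (e4 ^+ 2 * p - e6 * q) + e4 * (e4 * q - e6 * p)).
Proof.
move=> h4 h6 hp hq.
transitivity (8%:R * e4 * (3%:R * d4) * p + e4 ^+ 2 * (12%:R * dp)
  - 6%:R * (2%:R * d6) * q - e6 * (12%:R * dq)); first by ring.
by rewrite h4 h6 hp hq; ring.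
Qed.
End ExtremalStep.

Section Extremal.
Variable K : numFieldType.
Implicit Types (f g h : fps K) (u : fps K * fps K) (n : nat).
Local Notation E2 := (E2 K).
Local Notation E4 := (E4 K).
Local Notation E6 := (E6 K).
Local Notation disc := (disc K).

(* The factors make the pair starting at [(1, E2)] satisfy the first-order
   system of [extremal_deriv]. *)
Definition extremal_step n u : fps K * fps K :=
  ((6 * n + 7)%:R * (E4 * u.2 - E6 * u.1),
   (6 * n + 5)%:R * (E4 ^+ 2 * u.1 - E6 * u.2)).

Fixpoint extremal_iter n u : fps K * fps K :=
  if n is n'.+1 then extremal_step n' (extremal_iter n' u) else u.

(** General [s] and [w] serve three starting pairs: [(1, E2)] in depth 1 and, in depth 0, [(1, 0)]
    with [w = 0] and [(0, 1)] with [w = -2]. *)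
Lemma qmf_extremal_iter s w n u : qmf s w u.1 -> qmf s (w + 2) u.2 ->
  qmf s (w + (6 * n)%:Z) (extremal_iter n u).1 /\
  qmf s (w + (6 * n)%:Z + 2) (extremal_iter n u).2.
Proof.
move=> q1 q2; elim: n => [|n [IH1 IH2]] /=.
  by rewrite muln0 addr0.
have qE v k e g : qmf 0 k e -> qmf s v g -> qmf s (k + v) (e * g).
  by move=> qe qg; have := qmfM qe qg; rewrite add0n.
have qE4 := qmf_E4 K; have qE6 := qmf_E6 K.
have qE44 : qmf 0 8 (E4 ^+ 2) by rewrite expr2; exact: (qmfM qE4 qE4).
split; apply: qmf_nat; apply: qmfB.
- have := qE _ _ _ _ qE4 IH2; have -> // : 4 + (w + (6 * n)%:Z + 2) = w + (6 * n.+1)%:Z.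
  by lia.
- have := qE _ _ _ _ qE6 IH1; have -> // : 6 + (w + (6 * n)%:Z) = w + (6 * n.+1)%:Z.
  by lia.
- have := qE _ _ _ _ qE44 IH1.
  by have -> // : 8 + (w + (6 * n)%:Z) = w + (6 * n.+1)%:Z + 2; lia.
- have := qE _ _ _ _ qE6 IH2.
  by have -> // : 6 + (w + (6 * n)%:Z + 2) = w + (6 * n.+1)%:Z + 2; lia.
Qed.

Lemma extremal_iter_linear n u v f :
  extremal_iter n (u.1 + v.1 * f, u.2 + v.2 * f)
  = ((extremal_iter n u).1 + (extremal_iter n v).1 * f,
     (extremal_iter n u).2 + (extremal_iter n v).2 * f).
Proof.
by elim: n => //= n ->; rewrite /extremal_step /=; congr pair; ring.
Qed.

(** Up to its scalars a step has the matrix with rows [(- E6, E4)] and [(E4 ^+ 2, - E6)], of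
    determinant [- disc]. *)
Lemma extremal_iter_det n u v : exists2 c : nat, (0 < c)%N &
  (extremal_iter n u).1 * (extremal_iter n v).2
    - (extremal_iter n u).2 * (extremal_iter n v).1
  = c%:R * disc ^+ n * (-1) ^+ n * (u.1 * v.2 - u.2 * v.1).
Proof.
elim: n => [|n [c c0 e]]; first by exists 1%N => //=; ring.
exists ((6 * n + 7) * (6 * n + 5) * c)%N; first by rewrite !muln_gt0 c0; lia.
move: e; rewrite /= /extremal_step /=.
move: (extremal_iter n u) (extremal_iter n v) => [p q] [p' q'] /= e.
rewrite [in RHS]exprS [in X in _ = _ * X * _]exprS.
transitivity ((6 * n + 7)%:R * (6 * n + 5)%:R * (- disc) * (p * q' - q * p')).
  by rewrite /disc; ring.
by rewrite e !natrM; ring.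
Qed.

Definition extremal_pair n := extremal_iter n (1, E2).
Local Notation P n := (extremal_pair n).1.
Local Notation Q n := (extremal_pair n).2.

(** For [c = 6 n], differentiating the unscaled components produces the factors [c + 5] and [c + 7];
    the scalars [c + 7] and [c + 5] of [extremal_step] turn the result into the same system at
    [c + 6]. *)
Lemma extremal_deriv n (c : fps K := (6 * n)%:R) :
  12%:R * fps_deriv (P n) = (c - 1) * (E2 * P n) + (c + 1) * Q n /\
  12%:R * fps_deriv (Q n) = (c + 1) * (E2 * Q n) + (c - 1) * (E4 * P n).
Proof.
rewrite {}/c /extremal_pair; elim: n => [|n]; rewrite /= /extremal_step /=.
  by rewrite muln0 fps_deriv1 ramanujan_E2; split; ring.
have -> : (6 * n.+1)%:R = (6 * n)%:R + 6%:R :> fps K by rewrite -natrD mulnS addnC.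
rewrite !(natrD _ (6 * n)); move: (extremal_iter n _) => [p q] /= [hp hq].
move: ((6 * n)%:R : fps K) hp hq (fps_deriv_nat K (6 * n)) => c hp hq dc.
have dP := deriv_step_fst (ramanujan_E4 K) (ramanujan_E6 K) hp hq.
have dQ := deriv_step_snd (ramanujan_E4 K) (ramanujan_E6 K) hp hq.
split.
- transitivity ((c + 7%:R) * (12%:R * (fps_deriv E4 * q + E4 * fps_deriv q
    - (fps_deriv E6 * p + E6 * fps_deriv p)))).
    by rewrite !fps_derivE dc; ring.
  by rewrite dP; ring.
- transitivity ((c + 5%:R) * (12%:R * (2%:R * (E4 * fps_deriv E4) * p
    + E4 ^+ 2 * fps_deriv p - (fps_deriv E6 * q + E6 * fps_deriv q)))).
    by rewrite !expr2 !fps_derivE dc; ring.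
  by rewrite dQ; ring.
Qed.

Lemma coef0_E2 : fcoef E2 0 = 1. Proof. by []. Qed.
Lemma coef0_E4 : fcoef E4 0 = 1. Proof. by []. Qed.
Lemma coef0_E6 : fcoef E6 0 = 1. Proof. by []. Qed.
Definition coef0E := (coef0X, coef0_E2, coef0_E4, coef0_E6, expr1n).

Lemma extremal_pair_vanishes n : [/\ vanishes n (P n), vanishes n (Q n) &
  fcoef (P n) n = fcoef (Q n) n].
Proof.
elim: n => [|n [vP vQ PQ]]; first by split.
(* As [E4] and [E6] have constant term 1, the coefficient of index [n] in either new component is a
   multiple of the difference of those of [P n] and [Q n], which is 0. *)
have vP1 : vanishes n.+1 (P n.+1).
  rewrite /= /extremal_step /=; apply: vanishesMl; apply: vanishesS.
    by apply: vanishesB; apply: vanishesMl.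
  by rewrite coef_fpsD coef_fpsN !coef_vanishesMl // !coef0E !mul1r PQ subrr.
have vQ1 : vanishes n.+1 (Q n.+1).
  rewrite /= /extremal_step /=; apply: vanishesMl; apply: vanishesS.
    by apply: vanishesB; apply: vanishesMl.
  by rewrite coef_fpsD coef_fpsN !coef_vanishesMl // !coef0E !mul1r PQ subrr.
split=> //; have [dP _] := extremal_deriv n.+1.
(* For the coefficients [a] of [P n.+1] and [b] of [Q n.+1] this reads
   [12 (n + 1) a = (6 n + 5) a + (6 n + 7) b], and [12 (n + 1) - (6 n + 5) = 6 n + 7] is nonzero. *)
have := congr1 (fun f => fcoef f n.+1) dP.
have -> : (6 * n.+1)%:R - 1 = (6 * n + 5)%:R :> fps K.
  by rewrite mulnS (_ : 6 + 6 * n = (6 * n + 5) + 1)%N ?natrD ?addrK //; lia.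
have -> : (6 * n.+1)%:R + 1 = (6 * n + 7)%:R :> fps K.
  by rewrite natr1; congr _%:R; lia.
move: (P n.+1) (Q n.+1) vP1 {vQ1 dP} => p q vp.
rewrite coef_fpsD !fps_nat_scale coef_fps_deriv (coef_vanishesMl E2 vp) coef0E mul1r.
move: (fcoef p _) (fcoef q _) => a b.
rewrite !(natrD _ (6 * n)) (natrM _ 6) -[n.+1%:R]natr1 => e.
have n0 : (6 * n + 7)%:R != 0 :> K by rewrite pnatr_eq0; lia.
apply/(mulfI n0)/eqP; rewrite -subr_eq0; apply/eqP.
move: e => /eqP; rewrite -subr_eq0 => /eqP <-.
by rewrite (natrD _ (6 * n)) (natrM _ 6); ring.
Qed.

Lemma qmf_extremal_pair n : qmf 1 (6 * n)%N (P n) /\ qmf 1 (6 * n + 2)%N (Q n).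
Proof.
have q1 : qmf 1 0 (1 : fps K).
  by have := @qmf_monomial K 1 0 0 0 0 1 isT erefl; rewrite !mul1r scale1r.
have := @qmf_extremal_iter 1 0 n (1, E2) q1 (qmf_E2 K).
by rewrite !add0r PoszD.
Qed.

(** The coefficients of [P n] and [Q n] on [1] and [E2]. All have depth 0; [C n] has weights [6 n]
    and [6 n + 2], [D n] has weights [6 n - 2] and [6 n]. *)
Local Notation C n := (extremal_iter n (1, 0)).
Local Notation D n := (extremal_iter n (0, 1)).

Lemma extremal_pair_split n :
  P n = (C n).1 + (D n).1 * E2 /\ Q n = (C n).2 + (D n).2 * E2.
Proof.
have := extremal_iter_linear n (1, 0) (0, 1) E2.
by rewrite /= mul0r addr0 mul1r add0r -/(extremal_pair n) => ->.
Qed.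

Lemma extremal_det n : exists2 c : nat, (0 < c)%N &
  (C n).1 * (D n).2 - (C n).2 * (D n).1 = c%:R * disc ^+ n * (-1) ^+ n.
Proof.
have [c c0 e] := extremal_iter_det n (1, 0) (0, 1).
by exists c => //; rewrite e /= mul0r subr0 !mulr1.
Qed.

Lemma coef_signdisc c n : (0 < c)%N ->
  vanishes n (c%:R * disc ^+ n * (-1) ^+ n)
  /\ fcoef (c%:R * disc ^+ n * (-1) ^+ n) n != 0.
Proof.
move=> c0; have [vn dn] := vanishes_discX K n.
split; first by apply: vanishesMr; apply: vanishesMl.
have -> : c%:R * disc ^+ n * (-1) ^+ n = c%:R * ((-1) ^+ n * disc ^+ n) by ring.
rewrite fps_nat_scale coef_vanishesMl // coef0X.
have -> : fcoef (-1 : fps K) 0 = -1 by [].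
by rewrite !mulf_neq0 ?signr_eq0 // pnatr_eq0 -lt0n.
Qed.

(** Otherwise [P n] and [Q n], whose coefficients of index [n] agree, would both vanish to order
    [n + 1], and so would their determinant, which has order exactly [n]. *)
Lemma extremal_lead_neq0 n : fcoef (P n) n != 0.
Proof.
have [vP vQ PQ] := extremal_pair_vanishes n; apply/eqP => P0.
have vP1 : vanishes n.+1 (P n) by apply: vanishesS.
have vQ1 : vanishes n.+1 (Q n) by apply: vanishesS; rewrite -?PQ.
have [c c0 e] := extremal_det n; have [_ /eqP[]] := coef_signdisc n c0.
have [Ps Qs] := extremal_pair_split n.
suff -> : c%:R * disc ^+ n * (-1) ^+ n = P n * (D n).2 - Q n * (D n).1.
  by apply: (vanishesB (vanishesMr _ vP1) (vanishesMr _ vQ1)).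
by rewrite -e Ps Qs; ring.
Qed.

Lemma extremal_unique n h :
  (qmf 1 (6 * n)%N h -> vanishes n h -> exists x, h = x *: P n) /\
  (qmf 1 (6 * n + 2)%N h -> vanishes n h -> exists x, h = x *: Q n).
Proof.
have [vP vQ _] := extremal_pair_vanishes n.
have [Ps Qs] := extremal_pair_split n.
have [c c0 e] := extremal_det n; have [vd d0] := coef_signdisc n c0.
have qC : qmf 0 (6 * n)%:Z (C n).1 /\ qmf 0 ((6 * n)%:Z + 2) (C n).2.
  by have := @qmf_extremal_iter 0 0 n (1, 0) (qmf1 K) (qmf_zero _ _ _); rewrite add0r.
have qD : qmf 0 ((6 * n)%:Z - 2) (D n).1 /\ qmf 0 (6 * n)%:Z (D n).2.
  have := @qmf_extremal_iter 0 (- 2) n (0, 1) (qmf_zero _ _ _) (qmf1 K).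
  have -> : -2 + (6 * n)%:Z + 2 = (6 * n)%:Z by lia.
  by rewrite [-2 + _]addrC.
case: qC qD => qC1 qC2 [qD1 qD2].
(* Cramer's rule: the determinants of [h] with [Q n] and with [P n] are modular of weights [w + 6 n]
   and [w + 6 n - 2] and vanish to order [n]. [U] and [V] are their quotients by [disc ^+ n]. *)
have key w A B : h = A + B * E2 -> qmf 0 w A -> qmf 0 (w - 2) B -> vanishes n h ->
  exists U V, [/\ c%:R * disc ^+ n * (-1) ^+ n * h
      = disc ^+ n * (U * P n - V * Q n),
    qmf 0 (w - (6 * n)%:Z) U & qmf 0 (w - (6 * n)%:Z - 2) V].
  move=> hE qA qB vh.
  have [U [UE qU]] : exists U, A * (D n).2 - B * (C n).2 = disc ^+ n * U /\
      qmf 0 (w + (6 * n)%:Z - (12 * n)%:Z) U.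
    apply: modular_vanishes.
      apply: qmfB; first exact: (qmfM qA qD2).
      have := qmfM qB qC2.
      by have -> : w - 2 + ((6 * n)%:Z + 2) = w + (6 * n)%:Z by lia.
    suff -> : A * (D n).2 - B * (C n).2 = h * (D n).2 - Q n * B.
      by apply: vanishesB; apply: vanishesMr.
    by rewrite hE Qs; ring.
  have [V [VE qV]] : exists V, A * (D n).1 - B * (C n).1 = disc ^+ n * V /\
      qmf 0 (w - 2 + (6 * n)%:Z - (12 * n)%:Z) V.
    apply: modular_vanishes.
      apply: qmfB; last exact: (qmfM qB qC1).
      have := qmfM qA qD1.
      by have -> : w + ((6 * n)%:Z - 2) = w - 2 + (6 * n)%:Z by lia.
    suff -> : A * (D n).1 - B * (C n).1 = h * (D n).1 - P n * B.
      by apply: vanishesB; apply: vanishesMr.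
    by rewrite hE Ps; ring.
  exists U, V; split.
  - by rewrite mulrBr !mulrA -UE -VE -e hE Ps Qs; ring.
  - by have <- // : w + (6 * n)%:Z - (12 * n)%:Z = w - (6 * n)%:Z by lia.
  - by have <- // : w - 2 + (6 * n)%:Z - (12 * n)%:Z = w - (6 * n)%:Z - 2 by lia.
(* The common factor has a nonzero leading coefficient and can be cancelled; [(-1) ^+ n] is its own
   inverse. *)
have cancel x f : c%:R * disc ^+ n * (-1) ^+ n * h = disc ^+ n * (x *: f) ->
    h = ((-1) ^+ n * x / c%:R) *: f.
  move=> E; apply/eqP; rewrite -subr_eq0; apply/eqP.
  apply: (vanishes_mul_eq0 vd d0); rewrite mulrBr E.
  apply/eqP; rewrite subr_eq0; apply/eqP.
  have -> : c%:R * disc ^+ n * (-1) ^+ n * (((-1) ^+ n * x / c%:R) *: f)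
    = (-1) ^+ n * (c%:R * (disc ^+ n * (((-1) ^+ n * x / c%:R) *: f))) by ring.
  have sE y : (-1) ^+ n * y = ((-1) ^+ n : K) *: y :> fps K.
    rewrite -mulr_algl; congr (_ * _).
    by rewrite -[RHS]/(in_alg (fps K) _) rmorphXn rmorphN1.
  rewrite sE mulr_natl -scaler_nat -!scalerAr !scalerA; congr (_ *: _).
  have c1 : c%:R != 0 :> K by rewrite pnatr_eq0 -lt0n.
  move: ((-1) ^+ n) (sqrr_sign K n) => t t2.
  by transitivity (t ^+ 2 * x); [rewrite t2 mul1r | field].
(* The weights of [U] and [V] are 0 and -2 in the first case, 2 and 0 in the second: one is a
   constant and the other is zero. *)
split=> [/qmf_depth1[A [B [qA qB hE]]] vh | /qmf_depth1[A [B [qA qB hE]]] vh];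
  have [U [V [E qU qV]]] := key _ _ _ hE qA qB vh.
- have V0 : V = 0 by apply: (modular_no_weight qV); left; lia.
  have [|x Ux] := @modular_weight0 K U.
    by have := qU; rewrite subrr.
  by eexists; apply: cancel; rewrite E V0 mul0r subr0 Ux -scalerAl mul1r.
- have U0 : U = 0 by apply: (modular_no_weight qU); right; lia.
  have [|x Vx] := @modular_weight0 K V.
    by have := qV; have -> : (6 * n + 2)%N%:Z - (6 * n)%:Z - 2 = 0 by lia.
  exists ((-1) ^+ n * (- x) / c%:R); apply: cancel.
  by rewrite E U0 mul0r sub0r Vx -scalerAl mul1r scaleNr.
Qed.

(** * Identification of the normalized extremal forms *)

(** Forms of orders [0] to [n] force the dimension to exceed [n], so an extremal [f] vanishes to
    order [n] and is a multiple of [p n]. Its normalized coefficient must then sit at index [n],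
    which fixes the scalar. *)
Lemma normalized_extremal_multiple w n f (p : nat -> fps K) :
  (forall j, (j <= n)%N ->
    exists g, [/\ qmf 1 w%:Z g, vanishes j g & fcoef g j != 0]) ->
  (forall h, qmf 1 w%:Z h -> vanishes n h -> exists x, h = x *: p n) ->
  vanishes n (p n) -> fcoef (p n) n != 0 ->
  normalized_extremal w 1 f -> p n = fcoef (p n) n *: f.
Proof.
move=> basis uniq_p vp p0 [[/quasimodular_qmf qf _ [m [dim_m fm _]]] [k [fk f1]]].
have vf : vanishes n f.
  apply: (@vanishesW _ n m.-1) => //; suff : (n < m)%N by lia.
  have /choice[v vE] : forall j : 'I_n.+1, exists g,
      [/\ qmf 1 w%:Z g, vanishes j g & fcoef g j != 0].
    by move=> j; apply: basis; rewrite -ltnS.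
  have vE' j : (j < n.+1)%N -> [/\ qmf 1 w%:Z (v (inord j)),
      vanishes j (v (inord j)) & fcoef (v (inord j)) j != 0].
    by move=> jn; have := vE (inord j); rewrite inordK.
  apply: (has_dim_vanishes (v := fun j => v (inord j)) dim_m) => j /vE'[? ? ?] //.
  exact: qmf_quasimodular.
have [x fE] := uniq_p f qf vf.
have coefZ j : fcoef f j = x * fcoef (p n) j by rewrite fE.
case: (ltngtP k n) => [kn|nk|kn].
- by move: f1; rewrite vf // => /eqP; rewrite eq_sym oner_eq0.
- have /eqP := fk n nk; rewrite coefZ mulf_eq0 (negbTE p0) orbF => /eqP x0.
  by move: f1; rewrite coefZ x0 mul0r => /eqP; rewrite eq_sym oner_eq0.
- have xp : fcoef (p n) n * x = 1 by rewrite mulrC -coefZ -kn.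
  by rewrite fE scalerA xp scale1r.
Qed.

(** Multiplication by powers of [E6] raises the weight in steps of 6 and preserves the order of
    vanishing; it produces forms of one weight with every order up to [n]. *)
Lemma qmf_E6X n : qmf 0 (6 * n)%N (E6 ^+ n).
Proof.
elim: n => [|n IH]; first exact: qmf1.
rewrite exprS mulnS PoszD; exact: (qmfM (qmf_E6 K) IH).
Qed.

Lemma normalized_extremal_fst n f : normalized_extremal (6 * n) 1 f ->
  P n = fcoef (P n) n *: f.
Proof.
apply: (@normalized_extremal_multiple _ n f (fun n => P n)) => [j jn|h||].
- exists (E6 ^+ (n - j) * P j); have [vP _ _] := extremal_pair_vanishes j.
  have [qP _] := qmf_extremal_pair j; split; last 1 first.
  + by rewrite coef_vanishesMl // !coef0E mul1r extremal_lead_neq0.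
  + by have := qmfM (qmf_E6X (n - j)) qP; rewrite -PoszD -mulnDr subnK.
  + exact: vanishesMl.
- exact: (extremal_unique n h).1.
- by have [] := extremal_pair_vanishes n.
- exact: extremal_lead_neq0.
Qed.

(** The scalar is expressed through [P n], whose leading coefficient equals that of [Q n], so one
    constant serves both weights. *)
Lemma normalized_extremal_snd n f : normalized_extremal (6 * n + 2) 1 f ->
  Q n = fcoef (P n) n *: f.
Proof.
have [_ vQ ->] := extremal_pair_vanishes n.
apply: (@normalized_extremal_multiple _ n f (fun n => Q n)) => [j jn|h||].
- exists (E6 ^+ (n - j) * Q j); have [_ vQj PQ] := extremal_pair_vanishes j.
  have [_ qQ] := qmf_extremal_pair j; split; last 1 first.
  + by rewrite coef_vanishesMl // !coef0E mul1r -PQ extremal_lead_neq0.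
  + by have := qmfM (qmf_E6X (n - j)) qQ; rewrite -PoszD addnA -mulnDr subnK.
  + exact: vanishesMl.
- exact: (extremal_unique n h).2.
- by have [] := extremal_pair_vanishes n.
- by have [_ _ <-] := extremal_pair_vanishes n; apply: extremal_lead_neq0.
Qed.

(** Expanding [P n.+1] and [Q n.+1] by the recursion leaves the factors [E4 * E2 - E6] and
    [E4 ^+ 2 - E6 * E2], which are [P 1 / 7] and [Q 1 / 5]; hence [420 = 12 * 35]. *)
Lemma extremal_deriv_product n :
  420%:R * fps_deriv (P n.+1) = ((6 * n + 5) * (6 * n + 7))%:R
    * (5%:R * (P 1 * Q n) + 7%:R * (Q 1 * P n)).
Proof.
have [dP _] := extremal_deriv n.+1.
transitivity (35%:R * (12%:R * fps_deriv (P n.+1))); first by ring.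
have P1 : P 1 = 7%:R * (E4 * E2 - E6) by rewrite /= /extremal_step /= mulr1.
have Q1 : Q 1 = 5%:R * (E4 ^+ 2 - E6 * E2) by rewrite /= /extremal_step /= mulr1.
rewrite dP P1 Q1 {dP P1 Q1} /= /extremal_step /= -/(extremal_pair n).
have -> : (6 * n.+1)%:R = (6 * n)%:R + 6%:R :> fps K by rewrite -natrD mulnS addnC.
rewrite natrM !(natrD _ (6 * n)); move: (P n) (Q n) => p q; ring.
Qed.

Lemma normalized_extremal_deriv n (X6 X8 Y Z X : fps K) :
  normalized_extremal 6 1 X6 -> normalized_extremal 8 1 X8 ->
  normalized_extremal (6 * n) 1 Y -> normalized_extremal (6 * n + 2) 1 Z ->
  normalized_extremal (6 * n.+1) 1 X ->
  fps_deriv X = (5 * (6 * n.+1))%:R / 72%:R *: (X6 * Z)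
    + (7 * (6 * n.+1))%:R / 72%:R *: (X8 * Y).
Proof.
move=> /(@normalized_extremal_fst 1) h6 /(@normalized_extremal_snd 1) h8.
move=> /normalized_extremal_fst hY /normalized_extremal_snd hZ.
move=> /normalized_extremal_fst hX.
have d := extremal_deriv_product n.
have [v1P v1Q PQ1] := extremal_pair_vanishes 1.
have [vP vQ PQ] := extremal_pair_vanishes n.
have a0 := extremal_lead_neq0 n.+1.
(* The coefficient of index [n + 1] in [d] relates the three scaling constants, so none of them has
   to be computed. *)
have lead : 420%:R * (n.+1%:R * fcoef (P n.+1) n.+1) = ((6 * n + 5) * (6 * n + 7))%:R
    * (12%:R * (fcoef (P 1) 1 * fcoef (P n) n)).
  have -> : 12%:R * (fcoef (P 1) 1 * fcoef (P n) n)
      = 5%:R * (fcoef (P 1) 1 * fcoef (Q n) n) + 7%:R * (fcoef (Q 1) 1 * fcoef (P n) n).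
    by rewrite -PQ1 -PQ; ring.
  move: (P 1) (Q 1) (P n) (Q n) (P n.+1) v1P v1Q vP vQ d => p1 q1 p q g v1p v1q vp vq d.
  have := congr1 (fun f => fcoef f n.+1) d.
  rewrite fps_nat_scale coef_fps_deriv fps_nat_scale coef_fpsD !fps_nat_scale.
  by rewrite -(add1n n) !coef_vanishesM.
move: d; rewrite h6 h8 hX hY hZ => d.
apply/fpsP => i; have := congr1 (fun f => fcoef f i) d.
have scaleE x (f : fps K) : fcoef (x *: f) i = x * fcoef f i by [].
rewrite coef_fpsD !scaleE coef_fps_deriv.
move: a0 lead.
move: (fcoef (P n.+1) _) (fcoef (P 1) 1) (fcoef (P n) n) => a b c a0 lead.
rewrite fps_nat_scale coef_fps_deriv fps_nat_scale coef_fpsD !fps_nat_scale.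
rewrite -!scalerAl -!scalerAr !scalerA !scaleE.
move: (fcoef (X6 * Z) i) (fcoef (X8 * Y) i) (fcoef X i) => x y z e.
move: lead e; set k : K := (_ * _)%:R => lead e.
(* By [lead], the factor [12 * k * b * c] equals [420 (n + 1) a]; what remains is
   [(n + 1) / 12 = 6 (n + 1) / 72]. *)
apply: (mulfI (x := 420%:R * a)); first by rewrite mulf_neq0 // pnatr_eq0.
transitivity (k * (12%:R * (b * c)) * ((5%:R * x + 7%:R * y) / 12%:R)).
  transitivity (420%:R * (i%:R * (a * z))); first by ring.
  by rewrite e; field.
by rewrite -lead !natrM; field.
Qed.
End Extremal.

Theorem theorem4p3 (R : realType) (w : nat) (w_ge12 : (12 <= w)%N)
  (w_dvd6 : (6 %| w)%N) (X6 X8 Xw_6 Xw_4 Xw : fps R[i])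
  (hX6 : normalized_extremal 6 1 X6)
  (hX8 : normalized_extremal 8 1 X8)
  (hXw_6 : normalized_extremal (w - 6)%N 1 Xw_6)
  (hXw_4 : normalized_extremal (w - 4)%N 1 Xw_4)
  (hXw : normalized_extremal w 1 Xw) :
  fps_deriv Xw =
    ((5 * w)%:R / 72%:R) *: (X6 * Xw_4) + ((7 * w)%:R / 72%:R) *: (X8 * Xw_6).
Proof.
have [n wE] : exists n, w = (6 * n.+1)%N.
  by case/dvdnP: w_dvd6 => -[|n] e; [lia | exists n; lia].
have e6 : (w - 6 = 6 * n)%N by lia.
have e4 : (w - 4 = 6 * n + 2)%N by lia.
rewrite e6 in hXw_6; rewrite e4 in hXw_4; rewrite wE in hXw *.
exact: normalized_extremal_deriv hX6 hX8 hXw_6 hXw_4 hXw.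
Qed.
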